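(* Let $\phi$ be a positive continuous function on $(0,1)$ such that $g(x)=\int_x^1 \frac{\phi^2(t)}{t}\,dt<\infty$ for all $0<x<1$. Let $f\in B_\phi$. Then $$\|f_r\|_{BMOA}\le \|f\|_{B_\phi}\sqrt{g(1-r^2)},\qquad 0<r<1,$$ where $f_r(z)=f(rz)$.
   Context: $D=\{z\in\mathbb{C}:|z|<1\}$ is the open unit disk, and $m_2$ is normalized Lebesgue (area) measure on $D$, so $m_2(D)=1$. For an analytic function $f$ in $D$, define $\|f\|_{BMOA}\ge 0$ by $$\|f\|_{BMOA}^2=\sup_{\xi\in D}\iint_D |f'(z)|^2\,\frac{(1-|z|^2)(1-|\xi|^2)}{|1-\overline{\xi}z|^2}\,dm_2(z).$$ For a positive continuous function $\phi$ on $(0,1)$, $B_\phi$ denotes the space of all analytic functions $f$ in $D$ with $$\|f\|_{B_\phi}=\sup_{z\in D,\ z\neq 0}\frac{(1-|z|^2)\,|f'(z)|}{\phi(1-|z|^2)}<\infty.$$ For $0<r<1$, $f_r$ is the function $f_r(z)=f(rz)$. *)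

(* Defs.v *)
From mathcomp Require Import all_boot all_order all_algebra.
From mathcomp Require Import all_classical all_reals all_analysis.
From mathcomp Require Import complex.

Set Implicit Arguments.
Unset Strict Implicit.
Unset Printing Implicit Defensive.

Import Order.TTheory GRing.Theory Num.Theory.
Import numFieldNormedType.Exports.

Local Open Scope classical_set_scope.
Local Open Scope ring_scope.
Local Open Scope complex_scope.

(* The norm of R[i] is R[i]-valued, so moduli are written with the R-valued
   [Normc.normc]: for z : R[i], `|z| = (Normc.normc z)%:C. *)
Notation modc := ComplexField.Normc.normc.

Definition unit_disk (R : realType) : set R[i] := [set z | modc z < 1].

(* Seen as the one-dimensional normed space R[i]^o over itself, R[i] carries the
   norm topology, and [derivable _ z 1] is complex differentiability at z. *)
Definition analytic_in_disk (R : realType) (f : R[i] -> R[i]) : Prop :=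
  forall z : R[i], unit_disk z -> derivable (f : R[i]^o -> R[i]^o) z 1.

Definition cderiv (R : realType) (f : R[i] -> R[i]) (z : R[i]) : R[i] :=
  derive1 (f : R[i] -> R[i]^o) z.

Definition complex_of_pair (R : realType) (p : R * R) : R[i] := p.1 +i* p.2.

Lemma pi_inv_ge0 (R : realType) : 0 <= (pi : R)^-1.
Proof. by rewrite invr_ge0 pi_ge0. Qed.

(* Planar Lebesgue measure divided by the area pi of the unit disk. *)
Definition area_measure (R : realType) :
    {measure set (measurableTypeR R * measurableTypeR R) -> \bar R} :=
  mscale (NngNum (pi_inv_ge0 R)) (@lebesgue_measure R \x @lebesgue_measure R)%E.

Definition disk_integral (R : realType) (h : R[i] -> R) : \bar R :=
  (\int[area_measure R]_(p in @complex_of_pair R @^-1` @unit_disk R)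
     (h (complex_of_pair p))%:E)%E.

Definition BMOA_norm (R : realType) (f : R[i] -> R[i]) : \bar R :=
  sqrte (ereal_sup [set disk_integral (fun z =>
    modc (cderiv f z) ^+ 2 *
      ((1 - modc z ^+ 2) * (1 - modc xi ^+ 2) / modc (1 - xi^* * z) ^+ 2))
    | xi in @unit_disk R]).

Definition B_norm (R : realType) (phi : R -> R) (f : R[i] -> R[i]) : \bar R :=
  ereal_sup [set ((1 - modc z ^+ 2) * modc (cderiv f z) / phi (1 - modc z ^+ 2))%:E
    | z in [set z | @unit_disk R z /\ z != 0]].

Definition B_space (R : realType) (phi : R -> R) : set (R[i] -> R[i]) :=
  [set f | analytic_in_disk f /\ (B_norm phi f < +oo)%E].

Definition g_of (R : realType) (phi : R -> R) (x : R) : \bar R :=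
  (\int[@lebesgue_measure R]_(t in `]x, 1%R[) (phi t ^+ 2 / t)%:E)%E.

Definition dilate (R : realType) (r : R) (f : R[i] -> R[i]) : R[i] -> R[i] :=
  fun z => f (r%:C * z).

(* Main.v *)
Require Import Defs.
From HB Require Import structures.
From mathcomp Require Import all_boot all_order all_algebra.
From mathcomp Require Import all_classical all_reals all_analysis.
From mathcomp Require Import measurable_realfun complex.
From mathcomp Require Import ring lra.

Import Order.TTheory GRing.Theory Num.Theory.
Import numFieldNormedType.Exports.

Local Open Scope classical_set_scope.
Local Open Scope ring_scope.

(** Write M for the B_phi-norm of f, and s = |z|^2, t = 1 - r^2 s. The
    definition of M gives |f'(rz)| <= M phi(t) / t off the origin, and since
    1 - s <= t, the integrand defining the BMOA-norm of f_r is at most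
      M^2 (r^2 phi(t)^2 / t) (1 - |xi|^2) / |1 - conj(xi) z|^2,
    that is, M^2 times a radial function F(s) times a kernel whose average over
    the circle |z|^2 = s is (1 - |xi|^2) / (1 - |xi|^2 s) <= 1
    ([BMOA_integrand_le]). Hence the area integral is at most M^2 times the
    integral of F over ]0, 1[ ([integral_radial_poisson_le]), and the
    substitution t = 1 - r^2 s identifies the latter with g(1 - r^2)
    ([integral_radial_weight]). Taking the supremum over xi and square roots
    gives the result.

    Polar coordinates are replaced by slope coordinates. On each vertical line
    x <> 0 one puts y = x u; after exchanging the integrals, one folds x to
    positive values and, for a fixed slope u, puts s = (1 + u^2) x^2. Folding
    adds the values of the kernel at the antipodal points z and -z, and the sum
    is a rational function of u with a quadratic denominator
    ([poisson_kernel_antipodal]), whose integral over the line is an arctangent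
    integral ([integral_slope_kernel_le]). Both substitutions are instances of
    a change of variables for nonnegative measurable functions
    ([ge0_change_of_variables]), which follows from the uniqueness of the
    Lebesgue measure.

    Complex differentiability gives only the existence of f' at each point;
    neither its continuity nor its measurability is needed, because the integral
    of a nonnegative function, being a supremum over simple functions, is
    monotone without any measurability ([ge0_le_integral_nonmeas]). *)

(** * Change of variables on the real line *)

Section weighted_pushforward.
Import HBNNSimple.

(** If nu is the image under phi of the measure with density w with respect to
    mu, then integrals against nu are integrals against mu of the composite
    with phi, weighted by w. *)
Lemma integral_weighted_pushforward d1 d2 (X : measurableType d1)
    (Y : measurableType d2) (R : realType) (mu : {measure set X -> \bar R})
    (nu : {measure set Y -> \bar R}) (phi : X -> Y) (w : X -> R)
    (G : Y -> \bar R) :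
  measurable_fun setT phi -> measurable_fun setT w -> (forall x, 0 <= w x) ->
  (forall A, measurable A ->
    nu A = \int[mu]_x ((w x)%:E * (\1_A (phi x))%:E))%E ->
  measurable_fun setT G -> (forall y, 0 <= G y)%E ->
  (\int[nu]_y G y = \int[mu]_x ((w x)%:E * G (phi x)))%E.
Proof.
move=> mphi mw w0 nuE mG G0.
pose g := nnsfun_approx measurableT mG.
have mE (h : Y -> R) : measurable_fun setT h ->
    measurable_fun setT (fun x => (w x)%:E * (h (phi x))%:E)%E.
  move=> mh; apply: emeasurable_funM; apply/measurable_EFinP => //.
  exact: measurableT_comp.
have gG y : (g n y)%:E @[n --> \oo] --> G y.
  by apply: cvg_nnsfun_approx => // *; exact: G0.
have g_nd m n : (m <= n)%N -> forall y, g m y <= g n y.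
  by move=> mn; apply/lefP; exact: nd_nnsfun_approx.
transitivity (limn (fun n => \int[nu]_y (g n y)%:E))%E.
  rewrite -monotone_convergence//.
  - by apply: eq_integral => y _; apply/esym/cvg_lim => //; exact: gG.
  - by move=> n; exact/measurable_EFinP.
  - by move=> n y _; rewrite lee_fin.
  - by move=> y _ m n mn; rewrite lee_fin g_nd.
transitivity (limn (fun n => \int[mu]_x ((w x)%:E * (g n (phi x))%:E)))%E; last first.
  rewrite -monotone_convergence//.
  - apply: eq_integral => x _; apply/cvg_lim => //.
    by apply: cvgeZl => //; exact: gG.
  - by move=> n; exact: mE.
  - by move=> n x _; rewrite -EFinM lee_fin mulr_ge0.
  - by move=> x _ m n mn; rewrite -!EFinM lee_fin ler_wpM2l ?g_nd.
congr (limn _); apply/funext => n.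
under eq_integral do rewrite fimfunE -fsumEFin//.
under [RHS]eq_integral => x _.
  rewrite fimfunE -fsumEFin// ge0_mule_fsumr; last first.
    by move=> r; rewrite EFinM nnfun_muleindic_ge0.
  over.
rewrite !ge0_integral_fsum//.
- apply: eq_fsbigr => r /[!inE] -[y _ <-].
  under eq_integral do rewrite EFinM.
  rewrite ge0_integralZl//; last 2 first.
  + exact/measurable_EFinP.
  + by rewrite lee_fin.
  rewrite integral_indic// setIT nuE//.
  under [RHS]eq_integral do rewrite EFinM muleCA.
  rewrite ge0_integralZl//.
  + by apply: mE.
  + by move=> x _; rewrite -EFinM lee_fin mulr_ge0.
  + by rewrite lee_fin.
- move=> r.
  apply: (mE (fun y => r * \1_(g n @^-1` [set r]) y)).
  exact: measurable_funM.
- move=> r x _; rewrite mule_ge0 ?lee_fin//.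
  by rewrite -lee_fin EFinM nnfun_muleindic_ge0.
- by move=> r; apply/measurable_EFinP; exact: measurable_funM.
- by move=> r x _; rewrite EFinM nnfun_muleindic_ge0.
Qed.

End weighted_pushforward.

(** Substitution y = phi x for an increasing differentiable bijection phi of the
    line with continuous derivative w; the integrand G is only assumed to be
    measurable and nonnegative. *)
Lemma ge0_change_of_variables (R : realType) (phi w : R -> R)
    (G : R -> \bar R) :
  (forall x : R, is_derive x 1 phi (w x)) -> continuous w ->
  (forall x, 0 <= w x) -> {mono phi : x y / x <= y} ->
  (forall y, exists x, phi x = y) ->
  measurable_fun setT G -> (forall y, 0 <= G y)%E ->
  (\int[@lebesgue_measure R]_y G y
   = \int[@lebesgue_measure R]_x ((w x)%:E * G (phi x)))%E.
Proof.
move=> dphi cw w0 mphi sphi mG G0.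
have cphi : continuous phi.
  move=> x; apply: differentiable_continuous; apply/derivable1_diffP.
  by have [] := dphi x.
have mw : measurable_fun setT w by exact: continuous_measurable_fun.
have mp : measurable_fun setT phi by exact: continuous_measurable_fun.
pose nu0 (A : set (measurableTypeR R)) : \bar R :=
  (\int[@lebesgue_measure R]_(x in phi @^-1` A) (w x)%:E)%E.
have mpre (A : set (measurableTypeR R)) : measurable A ->
    measurable (phi @^-1` A : set (measurableTypeR R)).
  by move=> mA; rewrite -[X in measurable X]setTI; exact: mp.
have nu00 : nu0 set0 = 0%E by rewrite /nu0 preimage_set0 integral_set0.
have nu0_ge0 A : (0 <= nu0 A)%E.
  by apply: integral_ge0 => x _; rewrite lee_fin.
have nu0_sa : semi_sigma_additive nu0.
  move=> A mA tA mUA.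
  rewrite /nu0 preimage_bigcup ge0_integral_bigcup//.
  - apply: is_cvg_ereal_nneg_natsum_cond => n _ _.
    by apply: integral_ge0 => x _; rewrite lee_fin.
  - by move=> k; exact: mpre.
  - exact/measurable_EFinP/measurable_funTS.
  - by move=> x _; rewrite lee_fin.
  - apply/trivIsetP => i j _ _ ij.
    rewrite -preimage_setI.
    by move/trivIsetP : tA => ->//; rewrite preimage_set0.
pose nu : {measure set (measurableTypeR R) -> \bar R} :=
  HB.pack nu0 (isMeasure.Build _ _ _ nu0 nu00 nu0_ge0 nu0_sa).
(* The image nu of w dx under phi agrees with the Lebesgue measure on half-open
   intervals, by the fundamental theorem of calculus. *)
rewrite -(@integral_weighted_pushforward _ _ _ _ _ _ nu)//; last first.
  move=> A mA; rewrite /nu/= /nu0 integral_mkcond/=.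
  apply: eq_integral => x _; rewrite patchE indicE.
  have -> : (x \in phi @^-1` A) = (phi x \in A) by apply/idP/idP; rewrite !inE.
  by case: ifPn; rewrite ?mule1 ?mule0.
apply: eq_measure_integral => A mA _.
apply: lebesgue_measure_unique => // _ [[a b] _ <-]; rewrite /nu/= /nu0/=.
have [x xa] := sphi a; have [y yb] := sphi b.
have -> : phi @^-1` `]a, b] = `]x, y]%classic.
  apply/seteqP; split => z /=; rewrite !in_itv/= -xa -yb;
    by rewrite mphi !ltNge mphi.
have [xy|yx] := ltP x y.
  rewrite integral_itv_obnd_cbnd; last exact/measurable_EFinP/measurable_funTS.
  rewrite (continuous_FTC2 xy (F := phi)).
  - rewrite lebesgue_measure_itv/= lte_fin xa yb ifT// -xa -yb.
    by rewrite ltNge mphi -ltNge.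
  - exact: continuous_subspaceT.
  - split.
    + by move=> z _; have [] := dphi z.
    + exact/cvg_at_right_filter/cphi.
    + exact/cvg_at_left_filter/cphi.
  - by move=> z _; rewrite derive1E; have [_ ->] := dphi z.
have ba : b <= a by rewrite -xa -yb mphi.
by rewrite !set_itv_ge ?integral_set0 ?measure0// bnd_simp -leNgt.
Qed.

Lemma ge0_integral_opp (R : realType) (G : R -> \bar R) :
  measurable_fun setT G -> (forall y, 0 <= G y)%E ->
  (\int[@lebesgue_measure R]_y G y = \int[@lebesgue_measure R]_x G (- x)%R)%E.
Proof.
move=> mG G0.
rewrite -[RHS](@ge0_integral_pushforward _ _ (measurableTypeR R)
  (measurableTypeR R) R -%R _ lebesgue_measure setT)//.
apply: eq_measure_integral => A mA _.
exact/esym/lebesgue_measureN.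
Qed.

Lemma ge0_integral_affine (R : realType) (a b : R) (G : R -> \bar R) :
  a != 0 -> measurable_fun setT G -> (forall y, 0 <= G y)%E ->
  (\int[@lebesgue_measure R]_y G y =
   \int[@lebesgue_measure R]_x (`|a|%:E * G (a * x + b)%R))%E.
Proof.
have pos (c d : R) (H : R -> \bar R) : 0 < c ->
    measurable_fun setT H -> (forall y, 0 <= H y)%E ->
    (\int[@lebesgue_measure R]_y H y =
     \int[@lebesgue_measure R]_x (c%:E * H (c * x + d)%R))%E.
  move=> c0 mH H0.
  apply: (@ge0_change_of_variables _ (fun x => c * x + d) (fun=> c)) => //.
  - move=> x; apply: is_derive_eq; rewrite /GRing.scale/=; ring.
  - by move=> x; exact: cvg_cst.
  - by move=> _; exact: ltW.
  - by move=> x y; rewrite lerD2r ler_pM2l.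
  - by move=> y; exists ((y - d) / c); field; rewrite gt_eqF.
move=> a0 mG G0; have [a_gt0|a_lt0|] := ltgtP a 0; last by move/eqP: a0.
- rewrite ge0_integral_opp//.
  have mGN : measurable_fun setT (fun x : R => G (- x)).
    exact: measurableT_comp.
  rewrite (pos (- a) (- b) (fun x => G (- x)))//; last by rewrite oppr_gt0.
  rewrite ltr0_norm//; apply: eq_integral => x _.
  by congr (_ * G _)%E; ring.
- by rewrite gtr0_norm//; exact: pos.
Qed.

Lemma is_derive_mul_norm (R : realType) (x : R) :
  is_derive x 1 (fun t : R => t * `|t|) (2 * `|x|).
Proof.
have [x0|x0|->] := ltgtP x 0.
- have H : \near x, - x ^+ 2 = x * `|x|.
    near=> t; rewrite ltr0_norm; first by ring.
    by near: t; exact: lt_nbhsl.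
  apply: (near_eq_is_derive H).
  apply: is_derive_eq; rewrite /GRing.scale/= ltr0_norm//; ring.
- have H : \near x, x ^+ 2 = x * `|x|.
    near=> t; rewrite gtr0_norm; first by ring.
    by near: t; exact: lt_nbhsr.
  apply: (near_eq_is_derive H).
  apply: is_derive_eq; rewrite /GRing.scale/= gtr0_norm//; ring.
- rewrite normr0 mulr0.
  have H : (fun h : R => h^-1 *: ((h *: (1 : R) + 0) * `|h *: (1 : R) + 0| - 0 * `|0 : R|))
      @ 0^' --> (0 : R).
    apply: (@cvg_trans _ ((fun h : R => `|h|) @ 0^')).
      apply: near_eq_cvg; near=> h.
      rewrite /GRing.scale/= mulr1 addr0 mul0r subr0 mulKf//.
      by near: h; exact: nbhs_dnbhs_neq.
    have /cvg_norm : h @[h --> (0 : R)^'] --> (0 : R) by exact: nbhs_dnbhs.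
    by rewrite normr0; apply.
  by split; [apply/cvg_ex; exists 0; exact: H | exact: cvg_lim H].
Unshelve. all: by end_near. Qed.

(** Substitution y = c x^2 on the positive half-line, for G supported there. It
    is obtained from the bijection x |-> c x |x| of the whole line. *)
Lemma ge0_integral_square (R : realType) (c : R) (G : R -> \bar R) :
  0 < c -> measurable_fun setT G -> (forall y, 0 <= G y)%E ->
  (forall y, y <= 0 -> G y = 0%E) ->
  (\int[@lebesgue_measure R]_y G y =
   \int[@lebesgue_measure R]_(x in `]0%R, +oo[)
     ((2 * c * x)%:E * G (c * x ^+ 2)%R))%E.
Proof.
move=> c0 mG G0 Gneg.
rewrite [RHS]integral_mkcond.
have dphi (x : R) : is_derive x 1 (fun x : R => c * (x * `|x|)) (c * (2 * `|x|)).
  by have dx := is_derive_mul_norm _ x; apply: is_derive_eq.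
rewrite (ge0_change_of_variables _ _ _ _ dphi)//.
- apply: eq_integral => x _; rewrite patchE.
  have -> : (x \in [set` `]0%R, +oo[]) = (0 < x) by rewrite mem_setE in_itv/= andbT.
  case: ltP => x0.
    by rewrite gtr0_norm// expr2; congr (_%:E * _)%E; ring.
  by rewrite Gneg ?mule0// pmulr_rle0// mulr_le0_ge0.
- move=> x; apply: cvgM; first exact: cvg_cst.
  by apply: cvgM; [exact: cvg_cst | exact: cvg_norm].
- by move=> x; rewrite !mulr_ge0// ltW.
- move=> x y; rewrite ler_pM2l//.
  have [x0|x0] := leP 0 x; have [y0|y0] := leP 0 y.
  + by rewrite !ger0_norm// -!expr2 ler_pXn2r.
  + rewrite (ger0_norm x0) (ltr0_norm y0); apply/idP/idP; nra.
  + rewrite (ger0_norm y0) (ltr0_norm x0); apply/idP/idP; nra.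
  + rewrite !ltr0_norm//; apply/idP/idP; nra.
- move=> y; exists (Num.sg y * Num.sqrt (`|y| / c)).
  rewrite normrM [`|Num.sqrt _|]ger0_norm ?sqrtr_ge0//.
  rewrite mulrACA -expr2 sqr_sqrtr ?divr_ge0// ?ltW//.
  have [->|y0] := eqVneq y 0; first by rewrite sgr0 !mul0r mulr0.
  rewrite normr_sg y0 mulr1.
  rewrite [RHS]numEsg.
  by field; rewrite gt_eqF.
Qed.

Lemma ge0_integral_even_split (R : realType) (G : R -> \bar R) :
  measurable_fun setT G -> (forall y, 0 <= G y)%E ->
  (\int[@lebesgue_measure R]_x G x =
   \int[@lebesgue_measure R]_(x in `]0%R, +oo[) (G x + G (- x)%R))%E.
Proof.
move=> mG G0.
have mGN : measurable_fun setT (fun x : R => G (- x)).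
  exact: measurableT_comp.
rewrite ge0_integralD//; try exact: measurable_funTS.
transitivity
    (\int[@lebesgue_measure R]_(x in `]-oo, 0%R[ `|` `[0%R, +oo[) G x)%E.
  congr (integral _ _ _); apply/seteqP; split => // x _ /=.
  by rewrite !in_itv/= andbT; case: ltP; [left|right].
rewrite ge0_integral_setU//; last 2 first.
- exact: measurable_funTS.
- rewrite disj_set2E; apply/eqP; rewrite -subset0 => x [] /=.
  by rewrite !in_itv/= andbT ltNge => /negP.
rewrite addeC; congr (_ + _)%E.
  by rewrite integral_itv_obnd_cbnd//; exact: measurable_funTS.
rewrite integral_itv_obnd_cbnd; last exact: measurable_funTS.
rewrite integral_itv_bndo_bndc; last exact: measurable_funTS.
rewrite (ge0_integration_by_substitution0 mGN)//.
by apply: eq_integral => x _; rewrite opprK.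
Qed.

(** * Integrals of reciprocals of quadratic polynomials *)

Lemma measurable_oneDsqrV (R : realType) :
  measurable_fun setT (fun x : R => ((1 + x ^+ 2)^-1)%:E).
Proof.
apply/measurable_EFinP.
apply: (@continuous_measurable_fun R (fun x => (1 + x ^+ 2)^-1)).
exact: continuous_oneDsqrV.
Qed.

Lemma integral_oneDsqrV (R : realType) :
  (\int[@lebesgue_measure R]_x ((1 + x ^+ 2)^-1)%:E = (pi : R)%:E)%E.
Proof.
pose f (x : R) : \bar R := ((1 + x ^+ 2)^-1)%:E.
have mf : measurable_fun setT f by exact: measurable_oneDsqrV.
have f0 x : (0 <= f x)%E by rewrite lee_fin invr_ge0 addr_ge0 ?sqr_ge0.
have fN x : f (- x) = f x by rewrite /f sqrrN.
have half : (\int[@lebesgue_measure R]_(x in `]0%R, +oo[) f x = (pi / 2)%:E)%E.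
  rewrite integral_itv_obnd_cbnd; last exact: measurable_funTS.
  exact: integral0y_oneDsqr.
rewrite [LHS](ge0_integral_even_split _ _ mf f0).
under eq_integral do rewrite fN.
rewrite ge0_integralD//; try exact: measurable_funTS.
by rewrite half -EFinD; congr (_%:E); field.
Qed.

(** The discriminant condition turns the integrand, by the affine substitution
    v = (A u + B) / d, into a multiple of 1 / (1 + v^2). *)
Lemma integral_quadraticV (R : realType) (A B C d : R) :
  0 < A -> 0 < d -> A * C - B ^+ 2 = d ^+ 2 ->
  (\int[@lebesgue_measure R]_u ((A * u ^+ 2 + 2 * B * u + C)^-1)%:E
    = (pi / d)%:E)%E.
Proof.
move=> A0 d0 Ed.
have Ad0 : A / d != 0 by rewrite mulf_neq0 ?invr_neq0// gt_eqF.
pose f (x : R) : \bar R := ((1 + x ^+ 2)^-1)%:E.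
have mf : measurable_fun setT f.
  exact: measurable_oneDsqrV.
have f0 x : (0 <= f x)%E by rewrite lee_fin invr_ge0 addr_ge0 ?sqr_ge0.
rewrite EFinM muleC -integral_oneDsqrV -/(f _).
rewrite [X in (_ * X)%E](ge0_integral_affine _ (A / d) (B / d))//.
rewrite -ge0_integralZl//; last 3 first.
- apply: emeasurable_funM; first exact: measurable_cst.
  apply: (measurableT_comp mf).
  apply: continuous_measurable_fun => x.
  by apply: cvgD; [apply: cvgM; [exact: cvg_cst|exact: cvg_id] | exact: cvg_cst].
- by move=> x _; apply: mule_ge0; [rewrite lee_fin | exact: f0].
- by rewrite lee_fin invr_ge0 ltW.
apply: eq_integral => u _; rewrite gtr0_norm ?divr_gt0// /f -!EFinM.
congr (_%:E).
have -> : A * u ^+ 2 + 2 * B * u + C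
    = d ^+ 2 / A * (1 + (A / d * u + B / d) ^+ 2).
  have -> : C = (d ^+ 2 + B ^+ 2) / A.
    by rewrite -Ed; field; rewrite gt_eqF.
  by field; rewrite !gt_eqF.
have E0 : 1 + (A / d * u + B / d) ^+ 2 != 0.
  by rewrite gt_eqF// ltr_pwDl// sqr_ge0.
rewrite invfM mulrA invf_div; congr (_ * _).
by field; rewrite !gt_eqF.
Qed.

(** * The Poisson-type kernel in slope coordinates *)

Lemma measurable_funV_ge0 d (T : measurableType d) (R : realType) (f : T -> R) :
  (forall x, 0 <= f x) -> measurable_fun setT f ->
  measurable_fun setT (fun x => (f x)^-1).
Proof.
move=> f0 mf.
have -> : (fun x => (f x)^-1) = (fun x => f x `^ (-1)).
  by apply/funext => x; rewrite powR_inv1.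
exact: (measurableT_comp (measurable_powR (-1))).
Qed.

(** For xi = a + i b and z = x + i y, the number |1 - conj(xi) z|^2. *)
Definition poisson_den {R : realType} (a b x y : R) : R :=
  (1 - (a * x + b * y)) ^+ 2 + (a * y - b * x) ^+ 2.

(** For xi = a + i b and z = x + i y, the kernel
    (1 - |xi|^2) / |1 - conj(xi) z|^2. *)
Definition poisson_kernel {R : realType} (a b x y : R) : R :=
  (1 - (a ^+ 2 + b ^+ 2)) / poisson_den a b x y.

(** The number |1 - i u - w (1 + i u)|^2, where w = conj(xi)^2 s and
    xi = a + i b. When z = x (1 + i u) and s = |z|^2, one has
    z^2 = s (1 + i u) / (1 - i u), so that this number is
    |1 - conj(xi)^2 z^2|^2 (1 + u^2). *)
Definition slope_den {R : realType} (a b s u : R) : R :=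
  (1 - s * (a ^+ 2 - b ^+ 2) - 2 * s * (a * b) * u) ^+ 2 +
  (u - 2 * s * (a * b) + s * (a ^+ 2 - b ^+ 2) * u) ^+ 2.

(** Up to the factor 2 (1 + u^2), the sum of the values of the kernel at the two
    antipodal points with slope u on the circle |z|^2 = s. *)
Definition slope_kernel {R : realType} (a b s u : R) : R :=
  (1 - (a ^+ 2 + b ^+ 2)) * (1 + (a ^+ 2 + b ^+ 2) * s) / slope_den a b s u.

Lemma poisson_den_ge0 (R : realType) (a b x y : R) : 0 <= poisson_den a b x y.
Proof. by rewrite addr_ge0 ?sqr_ge0. Qed.

Lemma slope_den_ge0 (R : realType) (a b s u : R) : 0 <= slope_den a b s u.
Proof. by rewrite addr_ge0 ?sqr_ge0. Qed.

Lemma slope_kernel_ge0 (R : realType) (a b s u : R) :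
  a ^+ 2 + b ^+ 2 < 1 -> 0 <= s -> 0 <= slope_kernel a b s u.
Proof.
move=> ab s0; rewrite divr_ge0 ?slope_den_ge0// mulr_ge0//.
  by rewrite subr_ge0 ltW.
by rewrite addr_ge0// mulr_ge0// addr_ge0 ?sqr_ge0.
Qed.

Lemma poisson_den_gt0 (R : realType) (a b x y : R) :
  a ^+ 2 + b ^+ 2 < 1 -> x ^+ 2 + y ^+ 2 < 1 -> 0 < poisson_den a b x y.
Proof.
move=> ab xy; rewrite lt_neqAle poisson_den_ge0 andbT eq_sym paddr_eq0 ?sqr_ge0//.
rewrite !sqrf_eq0; apply/negP => /andP[/eqP h1 /eqP h2].
have h3 : (a ^+ 2 + b ^+ 2) * (x ^+ 2 + y ^+ 2) = 1.
  by transitivity ((a * x + b * y) ^+ 2 + (a * y - b * x) ^+ 2);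
    [ring | rewrite h2 (_ : a * x + b * y = 1); [ring | lra]].
have := sqr_ge0 a; have := sqr_ge0 b; have := sqr_ge0 x; have := sqr_ge0 y.
nra.
Qed.

Lemma poisson_kernel_antipodal (R : realType) (a b x u : R) :
  a ^+ 2 + b ^+ 2 < 1 -> (1 + u ^+ 2) * x ^+ 2 < 1 ->
  poisson_kernel a b x (x * u) + poisson_kernel a b (- x) (- x * u) =
  2 * (1 + u ^+ 2) * slope_kernel a b ((1 + u ^+ 2) * x ^+ 2) u.
Proof.
move=> ab xu.
have D1 : 0 < poisson_den a b x (x * u) by apply: poisson_den_gt0 => //; lra.
have D2 : 0 < poisson_den a b (- x) (- x * u).
  by apply: poisson_den_gt0 => //; lra.
have u0 : 0 < 1 + u ^+ 2 by rewrite ltr_pwDl ?sqr_ge0.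
have DD : slope_den a b ((1 + u ^+ 2) * x ^+ 2) u = (1 + u ^+ 2) *
    (poisson_den a b x (x * u) * poisson_den a b (- x) (- x * u)).
  by rewrite /slope_den /poisson_den; ring.
(* The sum of the squared distances |1 - w|^2 and |1 + w|^2 is 2 (1 + |w|^2). *)
have DS : poisson_den a b x (x * u) + poisson_den a b (- x) (- x * u) =
    2 * (1 + (a ^+ 2 + b ^+ 2) * ((1 + u ^+ 2) * x ^+ 2)).
  by rewrite /poisson_den; ring.
rewrite /poisson_kernel /slope_kernel DD.
move: DS D1 D2; set P := poisson_den _ _ _ _; set Q := poisson_den _ _ _ _.
move=> DS D1 D2.
have -> : 1 + (a ^+ 2 + b ^+ 2) * ((1 + u ^+ 2) * x ^+ 2) = (P + Q) / 2.
  by rewrite DS; field.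
by field; rewrite !gt_eqF.
Qed.

(** The integral is in fact pi (1 - |xi|^2) / (1 - |xi|^2 s). *)
Lemma integral_slope_kernel_le (R : realType) (a b s : R) :
  a ^+ 2 + b ^+ 2 < 1 -> 0 < s < 1 ->
  (\int[@lebesgue_measure R]_u (slope_kernel a b s u)%:E <= pi%:E)%E.
Proof.
move=> ab /andP[s0 s1].
set q := a ^+ 2 + b ^+ 2 in ab.
have q0 : 0 <= q by rewrite addr_ge0 ?sqr_ge0.
have sq1 : s * q < 1 by nra.
have d0 : 0 < 1 - (s * q) ^+ 2 by have : 0 <= s * q; nra.
(* slope_den a b s u = A u^2 + 2 B u + C, with A C - B^2 = (1 - (s q)^2)^2. *)
pose A := (2 * s * (a * b)) ^+ 2 + (1 + s * (a ^+ 2 - b ^+ 2)) ^+ 2.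
have A0 : 0 < A.
  rewrite ltr_wpDl ?sqr_ge0// exprn_gt0//.
  by move: sq1; rewrite /q; have := sqr_ge0 b; nra.
pose B := - 4 * s * (a * b).
pose C := (1 - s * (a ^+ 2 - b ^+ 2)) ^+ 2 + (2 * s * (a * b)) ^+ 2.
have E u : slope_kernel a b s u =
    (1 - q) * (1 + q * s) * (A * u ^+ 2 + 2 * B * u + C)^-1.
  by rewrite /slope_kernel -/q; congr (_ / _); rewrite /slope_den /A /B /C; ring.
have mk : measurable_fun setT
    (fun u : R => ((A * u ^+ 2 + 2 * B * u + C)^-1)%:E).
  apply/measurable_EFinP; apply: measurable_funV_ge0.
    move=> u; rewrite (_ : _ + C = slope_den a b s u) ?slope_den_ge0//.
    by rewrite /slope_den /A /B /C; ring.
  apply: measurable_funD => //; apply: measurable_funD.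
    by apply: measurable_funM => //; exact: measurable_funX.
  exact: measurable_funM.
under eq_integral do rewrite E EFinM.
rewrite ge0_integralZl_EFin//; last 2 first.
- move=> u _; rewrite lee_fin invr_ge0 (_ : _ + C = slope_den a b s u).
    exact: slope_den_ge0.
  by rewrite /slope_den /A /B /C; ring.
- by rewrite mulr_ge0//; nra.
rewrite (integral_quadraticV _ _ _ _ _ A0 d0); last by rewrite /A /B /C /q; ring.
rewrite -EFinM lee_fin.
have -> : (1 - q) * (1 + q * s) * (pi / (1 - (s * q) ^+ 2)) =
    pi * ((1 - q) / (1 - s * q)).
  by field; apply/andP; split; rewrite gt_eqF//; lra.
rewrite ler_piMr ?pi_ge0// ler_pdivrMr; last lra.
nra.
Qed.

Lemma measurable_poisson_kernel d (T : measurableType d) (R : realType)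
    (a b : R) (x y : T -> R) :
  measurable_fun setT x -> measurable_fun setT y ->
  measurable_fun setT (fun t => poisson_kernel a b (x t) (y t)).
Proof.
move=> mx my; apply: measurable_funM => //.
apply: measurable_funV_ge0 => [t|]; first exact: poisson_den_ge0.
apply: measurable_funD; apply: measurable_funX; apply: measurable_funB => //.
- by apply: measurable_funD; exact: measurable_funM.
- exact: measurable_funM.
- exact: measurable_funM.
Qed.

Lemma measurable_slope_kernel d (T : measurableType d) (R : realType)
    (a b : R) (s u : T -> R) :
  measurable_fun setT s -> measurable_fun setT u ->
  measurable_fun setT (fun t => slope_kernel a b (s t) (u t)).
Proof.
move=> ms mu; apply: measurable_funM.
  apply: measurable_funM => //; apply: measurable_funD => //.
  exact: measurable_funM.
apply: measurable_funV_ge0 => [t|]; first exact: slope_den_ge0.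
apply: measurable_funD; apply: measurable_funX.
- apply: measurable_funB.
    by apply: measurable_funB => //; exact: measurable_funM.
  apply: measurable_funM => //; apply: measurable_funM => //.
  exact: measurable_funM.
- apply: measurable_funD.
    apply: measurable_funB => //; apply: measurable_funM => //.
    exact: measurable_funM.
  by apply: measurable_funM => //; exact: measurable_funM.
Qed.

(** * Integrating a radial function against the kernel *)

(** The function F(|z|^2) (1 - |xi|^2) / |1 - conj(xi) z|^2 of z = x + i y, for
    xi = a + i b, set to 0 on the axis x = 0, where the slope y / x is
    undefined. *)
Definition radial_poisson {R : realType} (F : R -> R) (a b x y : R) : R :=
  if x == 0 then 0 else F (x ^+ 2 + y ^+ 2) * poisson_kernel a b x y.

Lemma measurable_radial_poisson d (T : measurableType d) (R : realType)
    (F : R -> R) (a b : R) (x y : T -> R) :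
  measurable_fun setT F -> measurable_fun setT x -> measurable_fun setT y ->
  measurable_fun setT (fun t => radial_poisson F a b (x t) (y t)).
Proof.
move=> mF mx my; apply: measurable_fun_ifT => //.
  exact: measurable_fun_eqr.
apply: measurable_funM; last exact: measurable_poisson_kernel.
by apply: (measurableT_comp mF); apply: measurable_funD; exact: measurable_funX.
Qed.

Lemma radial_poisson_ge0 (R : realType) (F : R -> R) (a b x y : R) :
  (forall s, 0 <= F s) -> a ^+ 2 + b ^+ 2 < 1 -> 0 <= radial_poisson F a b x y.
Proof.
move=> F0 ab; rewrite /radial_poisson; case: ifP => // _.
rewrite mulr_ge0// divr_ge0 ?poisson_den_ge0// subr_ge0; exact: ltW.
Qed.

(** The circle averages of the kernel are at most 1, whence the bound by the
    integral of F in the variable s = |z|^2; the constant pi comes from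
    dx dy = (1/2) ds dtheta. *)
Lemma integral_radial_poisson_le (R : realType) (F : R -> R) (a b : R) :
  measurable_fun setT F -> (forall s, 0 <= F s) ->
  (forall s, ~~ (0 < s < 1) -> F s = 0) -> a ^+ 2 + b ^+ 2 < 1 ->
  (\int[@lebesgue_measure R \x @lebesgue_measure R]_p
     (radial_poisson F a b p.1 p.2)%:E
   <= pi%:E * \int[@lebesgue_measure R]_s (F s)%:E)%E.
Proof.
move=> mF F0 Fout ab.
have h0 x y : 0 <= radial_poisson F a b x y by exact: radial_poisson_ge0.
have FK0 s u : 0 <= F s * slope_kernel a b s u.
  have [/andP[s0 _]|/Fout ->] := boolP (0 < s < 1); last by rewrite mul0r.
  by rewrite mulr_ge0// slope_kernel_ge0// ltW.
have mh : measurable_fun setT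
    (fun p : R * R => (radial_poisson F a b p.1 p.2)%:E).
  apply/measurable_EFinP; apply: measurable_radial_poisson => //.
have step (I1 I2 I3 : \bar R) : (I1 = I2 -> I2 <= I3 -> I1 <= I3)%E by move=> ->.
apply: (step _ _ _ (@fubini_tonelli1 _ _ (measurableTypeR R) (measurableTypeR R) R
  (@lebesgue_measure R) (@lebesgue_measure R) _ mh _)).
  by move=> p; rewrite lee_fin.
(* Substitution y = x u on the vertical lines x <> 0. *)
apply: (step _ (\int[@lebesgue_measure R]_x \int[@lebesgue_measure R]_u
    (`|x| * radial_poisson F a b x (x * u))%:E)%E).
  apply: eq_integral => x _; rewrite /fubini_F/=.
  have [->|x0] := eqVneq x 0.
    rewrite !integral0_eq// => y _; first by rewrite normr0 mul0r.
    by rewrite /radial_poisson eqxx.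
  rewrite (ge0_integral_affine _ x 0)//; last 2 first.
  - by apply/measurable_EFinP; apply: measurable_radial_poisson.
  - by move=> y; rewrite lee_fin.
  by apply: eq_integral => u _; rewrite addr0 EFinM.
have mk : measurable_fun setT (fun p : R * R =>
    (`|p.1| * radial_poisson F a b p.1 (p.1 * p.2))%:E).
  apply/measurable_EFinP; apply: measurable_funM.
    exact: measurableT_comp.
  by apply: measurable_radial_poisson => //; exact: measurable_funM.
apply: (step _ _ _ (@fubini_tonelli _ _ (measurableTypeR R) (measurableTypeR R) R
  (@lebesgue_measure R) (@lebesgue_measure R) _ mk _)).
  by move=> p; rewrite lee_fin mulr_ge0.
(* For a fixed slope u, fold x to positive values and put s = (1 + u^2) x^2. *)
apply: (step _ (\int[@lebesgue_measure R]_u \int[@lebesgue_measure R]_s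
    (F s * slope_kernel a b s u)%:E)%E).
  apply: eq_integral => u _.
  have u0 : 0 < 1 + u ^+ 2 by rewrite ltr_pwDl ?sqr_ge0.
  rewrite [LHS]ge0_integral_even_split/=; last 2 first.
  - apply/measurable_EFinP; apply: measurable_funM.
      exact: normr_measurable.
    apply: (measurable_radial_poisson _ _ _ F a b id (fun x => x * u)) => //.
    exact: measurable_funM.
  - by move=> y; rewrite lee_fin mulr_ge0.
  rewrite (ge0_integral_square _ _ _ u0); last 3 first.
  - apply/measurable_EFinP; apply: measurable_funM => //.
    exact: measurable_slope_kernel.
  - by move=> y; rewrite lee_fin.
  - by move=> y y0; rewrite Fout ?mul0r// negb_and -leNgt y0.
  apply: eq_integral => x; rewrite inE/= in_itv/= andbT => x0.
  rewrite -EFinD -EFinM; congr (_%:E).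
  rewrite /radial_poisson oppr_eq0 gt_eqF// normrN gtr0_norm//.
  have -> : x ^+ 2 + (x * u) ^+ 2 = (1 + u ^+ 2) * x ^+ 2 by ring.
  have -> : (- x) ^+ 2 + (- x * u) ^+ 2 = (1 + u ^+ 2) * x ^+ 2 by ring.
  have [/andP[_ xu]|/Fout ->] := boolP (0 < (1 + u ^+ 2) * x ^+ 2 < 1); last first.
    by rewrite !mul0r !mulr0 addr0.
  rewrite -mulrDr -mulrDr poisson_kernel_antipodal//; ring.
(* Integrate in u first. *)
have mFK : measurable_fun setT
    (fun p : R * R => (F p.2 * slope_kernel a b p.2 p.1)%:E).
  apply/measurable_EFinP; apply: measurable_funM => //.
    exact: (measurableT_comp mF).
  exact: measurable_slope_kernel.
apply: (step _ _ _ (@fubini_tonelli _ _ (measurableTypeR R) (measurableTypeR R) R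
  (@lebesgue_measure R) (@lebesgue_measure R) _ mFK _)) => /=.
  by move=> p; rewrite lee_fin.
rewrite -ge0_integralZl//; last 3 first.
- exact/measurable_EFinP.
- by move=> s _; rewrite lee_fin.
- by rewrite lee_fin pi_ge0.
apply: ge0_le_integral => //.
- by move=> s _; apply: integral_ge0 => u _; rewrite lee_fin.
- apply: (@measurable_fun_fubini_tonelli_G _ _ (measurableTypeR R)
    (measurableTypeR R) R (@lebesgue_measure R) _ mFK).
  by move=> p; rewrite lee_fin.
- by apply: measurable_funeM; exact/measurable_EFinP.
- move=> s _.
  have [s01|/Fout ->] := boolP (0 < s < 1); last first.
    by rewrite mule0 integral0_eq// => u _; rewrite mul0r.
  under eq_integral do rewrite EFinM.
  rewrite ge0_integralZl_EFin//; last 2 first.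
  + move=> u _; rewrite lee_fin slope_kernel_ge0//.
    by case/andP: s01 => /ltW.
  + by apply/measurable_EFinP; exact: measurable_slope_kernel.
  rewrite muleC; apply: lee_wpmul2r; first by rewrite lee_fin.
  exact: integral_slope_kernel_le.
Qed.

(** * Complex derivatives and the B_phi-norm *)

Lemma derive1_comp_mull (K : numFieldType) (f : K^o -> K^o) (c z : K) :
  derivable f (c * z) 1 ->
  derive1 (fun w : K => f (c * w)) z = c * derive1 f (c * z).
Proof.
move=> /derivable1_diffP df.
pose g : K^o -> K^o := c *: id.
have dg : is_diff (z : K^o) g g by exact: is_diff_eq.
have dgf : differentiable g (z : K^o) by [].
have df' : differentiable f (g z) by [].
rewrite (_ : (fun w : K => f (c * w)) = f \o g)//.
rewrite derive1E'; last exact: differentiable_comp.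
rewrite diff_comp//= diff_val derive1E'//.
by rewrite (_ : g 1 = c *: (1 : K^o))// linearZ.
Qed.

Lemma sqr_modc (R : realType) (z : R[i]) :
  modc z ^+ 2 = complex.Re z ^+ 2 + complex.Im z ^+ 2.
Proof. by case: z => x y /=; rewrite sqr_sqrtr// addr_ge0 ?sqr_ge0. Qed.

Lemma modc_ge0 (R : realType) (z : R[i]) : 0 <= modc z.
Proof. by case: z => x y /=; rewrite sqrtr_ge0. Qed.

Lemma unit_diskP (R : realType) (z : R[i]) :
  unit_disk z <-> complex.Re z ^+ 2 + complex.Im z ^+ 2 < 1.
Proof.
rewrite -sqr_modc /unit_disk /=; split => h.
  by rewrite expr_lt1// modc_ge0.
by move: h; rewrite expr_lt1// modc_ge0.
Qed.

Lemma modc_real (R : realType) (r : R) : modc (r%:C)%C = `|r|.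
Proof. by rewrite /= expr0n addr0 sqrtr_sqr. Qed.

Lemma cderiv_dilate (R : realType) (f : R[i] -> R[i]) (r : R) (z : R[i]) :
  analytic_in_disk f -> unit_disk ((r%:C)%C * z) ->
  cderiv (dilate r f) z = (r%:C)%C * cderiv f ((r%:C)%C * z).
Proof. by move=> fA rz; apply: derive1_comp_mull; exact: fA. Qed.

Lemma B_norm_ge (R : realType) (phi : R -> R) (f : R[i] -> R[i]) (z : R[i]) :
  unit_disk z -> z != 0 ->
  (((1 - modc z ^+ 2) * modc (cderiv f z) / phi (1 - modc z ^+ 2))%:E
    <= B_norm phi f)%E.
Proof. by move=> zD z0; apply: ereal_sup_ubound; exists z. Qed.

Lemma B_norm_ge0 (R : realType) (phi : R -> R) (f : R[i] -> R[i]) :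
  {in `]0, 1[, forall t : R, 0 < phi t} -> (0 <= B_norm phi f)%E.
Proof.
move=> phi_gt0.
(* Any nonzero point of the disk will do. *)
pose z : R[i] := ((2^-1 : R)%:C)%C.
have z2 : modc z ^+ 2 = 4^-1.
  by rewrite /z modc_real real_normK ?num_real//; field.
apply: (@le_trans _ _ _ _ _ _ (B_norm_ge _ phi f z _ _)).
- rewrite lee_fin z2 divr_ge0 ?mulr_ge0 ?modc_ge0//; first by lra.
  by apply/ltW/phi_gt0; rewrite in_itv/=; lra.
- rewrite /unit_disk [X in X _]/mkset /z modc_real ger0_norm//; lra.
- by rewrite eq_complex/= negb_and invr_eq0 pnatr_eq0.
Qed.

Lemma B_norm_bound (R : realType) (phi : R -> R) (f : R[i] -> R[i]) (z : R[i]) :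
  {in `]0, 1[, forall t : R, 0 < phi t} -> B_space phi f ->
  unit_disk z -> z != 0 ->
  (1 - modc z ^+ 2) * modc (cderiv f z) <=
    fine (B_norm phi f) * phi (1 - modc z ^+ 2).
Proof.
move=> phi_gt0 [_ fB] zD z0.
have z2 : 0 < modc z ^+ 2.
  rewrite exprn_gt0// lt_neqAle modc_ge0 andbT eq_sym.
  by apply: contra z0 => /eqP/ComplexField.Normc.eq0_normc ->.
have z2' : modc z ^+ 2 < 1 by rewrite expr_lt1// modc_ge0.
rewrite -ler_pdivrMr; last by apply: phi_gt0; rewrite in_itv/=; lra.
rewrite -lee_fin fineK; first exact: B_norm_ge.
by rewrite ge0_fin_numE// B_norm_ge0.
Qed.

Lemma modc_poisson_den (R : realType) (xi z : R[i]) :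
  modc (1 - xi^*%C * z) ^+ 2 =
  poisson_den (complex.Re xi) (complex.Im xi) (complex.Re z) (complex.Im z).
Proof.
by case: xi z => [a b] [x y]; rewrite sqr_modc /poisson_den /=; ring.
Qed.

(** * The radial weight and the bound on the area integral *)

(** The function phi(t)^2 / t for t in ]1 - r^2, 1[, extended by 0. Using |t| in
    the denominator changes no value and makes the denominator nonnegative
    everywhere. *)
Definition radial_weight {R : realType} (phi : R -> R) (r t : R) : R :=
  (phi \_ `](1 - r ^+ 2)%R, 1%R[) t ^+ 2 / `|t|.

Lemma measurable_radial_weight (R : realType) (phi : R -> R) (r : R) :
  {within `]0, 1[, continuous phi} -> r ^+ 2 < 1 ->
  measurable_fun setT (radial_weight phi r).
Proof.
move=> phi_cont r1; apply: measurable_funM.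
  apply: measurable_funX; apply/(measurable_restrictT _ _).1 => //.
  have mphi : measurable_fun (`]0, 1[%classic : set R) phi.
    exact: subspace_continuous_measurable_fun.
  apply: measurable_funS mphi => //.
  by apply: subset_itv; rewrite bnd_simp// subr_ge0 ltW.
by apply: measurable_funV_ge0 => // x; exact: normr_measurable.
Qed.

Lemma integral_radial_weight (R : realType) (phi : R -> R) (r : R) :
  {within `]0, 1[, continuous phi} -> 0 < r -> r < 1 ->
  (\int[@lebesgue_measure R]_s
     (r ^+ 2 * radial_weight phi r (1 - r ^+ 2 * s))%:E
   = g_of phi (1 - r ^+ 2))%E.
Proof.
move=> phi_cont r0 r1.
have r2 : 0 < r ^+ 2 by rewrite exprn_gt0.
have r21 : r ^+ 2 < 1 by rewrite expr_lt1 ?ltW.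
have mw : measurable_fun setT (fun t => (radial_weight phi r t)%:E).
  by apply/measurable_EFinP; exact: measurable_radial_weight.
rewrite /g_of [RHS]integral_mkcond.
transitivity (\int[@lebesgue_measure R]_t (radial_weight phi r t)%:E)%E.
  rewrite [RHS](ge0_integral_affine _ (- r ^+ 2) 1).
  - apply: eq_integral => s _; rewrite normrN gtr0_norm// EFinM.
    by rewrite mulNr addrC.
  - by rewrite oppr_eq0 gt_eqF.
  - exact: mw.
  - by move=> t; rewrite lee_fin divr_ge0 ?sqr_ge0.
apply: eq_integral => t _; rewrite /radial_weight !patchE.
case: ifPn => [|_]; last by rewrite expr0n/= mul0r.
rewrite inE/= in_itv/= => /andP[t0 _].
by rewrite ger0_norm//; apply: ltW; apply: le_lt_trans t0; rewrite subr_ge0 ltW.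
Qed.

(** With M the B_phi-norm of f, the integrand is at most M^2 times the kernel
    multiplied by the radial function r^2 phi(t)^2 / t, t = 1 - r^2 |z|^2. *)
Lemma BMOA_integrand_le (R : realType) (phi : R -> R) (f : R[i] -> R[i])
    (r a b x y : R) :
  {in `]0, 1[, forall t : R, 0 < phi t} -> B_space phi f ->
  0 < r -> r < 1 -> a ^+ 2 + b ^+ 2 < 1 -> x ^+ 2 + y ^+ 2 < 1 -> x != 0 ->
  modc (cderiv (dilate r f) (x +i* y)%C) ^+ 2 *
    ((1 - (x ^+ 2 + y ^+ 2)) * (1 - (a ^+ 2 + b ^+ 2)) / poisson_den a b x y) <=
  fine (B_norm phi f) ^+ 2 *
    radial_poisson (fun s => r ^+ 2 * radial_weight phi r (1 - r ^+ 2 * s))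
      a b x y.
Proof.
move=> phi_gt0 fB r0 r1 ab xy x0.
set z := (x +i* y)%C; set M := fine _; set s := x ^+ 2 + y ^+ 2 in xy *.
have s0 : 0 < s by rewrite ltr_pwDl ?sqr_ge0// lt_neqAle sqr_ge0 eq_sym sqrf_eq0 x0.
have r2 : 0 < r ^+ 2 by rewrite exprn_gt0.
have r21 : r ^+ 2 < 1 by rewrite expr_lt1 ?ltW.
have zs : modc z ^+ 2 = s by rewrite sqr_modc.
have rzs : modc ((r%:C)%C * z) ^+ 2 = r ^+ 2 * s.
  by rewrite ComplexField.Normc.normcM exprMn zs modc_real real_normK ?num_real.
have rzD : unit_disk ((r%:C)%C * z).
  by apply/unit_diskP; rewrite -sqr_modc rzs; nra.
have rz0 : (r%:C)%C * z != 0.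
  apply/negP => /eqP e; move: rzs; rewrite e ComplexField.Normc.normc0 expr0n/=.
  by move/eqP; rewrite eq_sym gt_eqF// mulr_gt0.
rewrite cderiv_dilate//; last by case: fB.
rewrite ComplexField.Normc.normcM modc_real (gtr0_norm r0).
have := B_norm_bound _ _ _ _ phi_gt0 fB rzD rz0; rewrite rzs -/M.
set t := 1 - r ^+ 2 * s; set D := modc (cderiv _ _) => Dle.
have t0 : 0 < t by rewrite /t; nra.
have D0 : 0 <= D by exact: modc_ge0.
rewrite /radial_poisson (negbTE x0) -/s -/t /poisson_kernel /radial_weight patchE.
rewrite ifT; last by rewrite inE/= in_itv/= /t; apply/andP; split; nra.
rewrite (gtr0_norm t0).
set P := poisson_den _ _ _ _.
have P0 : 0 < P by exact: poisson_den_gt0.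
have Q0 : 0 <= (1 - (a ^+ 2 + b ^+ 2)) / P by rewrite divr_ge0 ?(ltW P0)// subr_ge0 ltW.
(* From t D <= M phi(t), since 1 - s <= t. *)
have key : D ^+ 2 * (1 - s) <= M ^+ 2 * (phi t ^+ 2 / t).
  rewrite mulrA ler_pdivlMr// -exprMn.
  apply: (@le_trans _ _ ((t * D) ^+ 2)); last first.
    have tD0 : 0 <= t * D by rewrite mulr_ge0// ltW.
    by apply: lerXn2r => //; rewrite nnegrE// (le_trans tD0).
  have st : 1 - s <= t by rewrite /t; nra.
  have : 0 <= D ^+ 2 * t by rewrite mulr_ge0 ?sqr_ge0 ?ltW.
  nra.
rewrite exprMn.
have -> : r ^+ 2 * D ^+ 2 * ((1 - s) * (1 - (a ^+ 2 + b ^+ 2)) / P) =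
   r ^+ 2 * ((1 - (a ^+ 2 + b ^+ 2)) / P) * (D ^+ 2 * (1 - s)).
  by ring.
have -> : M ^+ 2 * (r ^+ 2 * (phi t ^+ 2 / t) * ((1 - (a ^+ 2 + b ^+ 2)) / P)) =
   r ^+ 2 * ((1 - (a ^+ 2 + b ^+ 2)) / P) * (M ^+ 2 * (phi t ^+ 2 / t)).
  by ring.
by apply: ler_wpM2l => //; rewrite mulr_ge0// ltW.
Qed.

Lemma lebesgue2_vertical_axis (R : realType) :
  ((@lebesgue_measure R \x @lebesgue_measure R) ([set 0%R] `*` setT) = 0)%E.
Proof.
rewrite product_measure1E//.
rewrite [X in (X * _)%E](_ : _ = 0)%E ?mul0e//; exact: lebesgue_measure_set1.
Qed.

(** Monotonicity of the integral of nonnegative functions, with no measurability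
    hypothesis. *)
Lemma ge0_le_integral_nonmeas d (T : measurableType d) (R : realType)
    (mu : {measure set T -> \bar R}) (f g : T -> \bar R) :
  (forall x, 0 <= f x)%E -> (forall x, f x <= g x)%E ->
  (\int[mu]_x f x <= \int[mu]_x g x)%E.
Proof.
move=> f0 fg.
have g0 x : (0 <= g x)%E by exact: le_trans (fg x).
rewrite !ge0_integralTE//; apply: ereal_sup_le => _ [h hf <-].
by exists h => // x; exact: le_trans (fg x).
Qed.

(** The area integral at a fixed xi is at most M^2 g(1 - r^2), M being the
    B_phi-norm of f. *)
Lemma disk_integral_le (R : realType) (phi : R -> R) (f : R[i] -> R[i])
    (r : R) (xi : R[i]) :
  {in `]0, 1[, forall t : R, 0 < phi t} -> {within `]0, 1[, continuous phi} ->
  B_space phi f -> 0 < r -> r < 1 -> unit_disk xi ->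
  (disk_integral (fun z => (modc (cderiv (dilate r f) z) ^+ 2 *
      ((1 - modc z ^+ 2) * (1 - modc xi ^+ 2) / modc (1 - xi^*%C * z) ^+ 2))%R)
   <= (fine (B_norm phi f) ^+ 2)%:E * g_of phi (1 - r ^+ 2))%E.
Proof.
move=> phi_gt0 phi_cont fB r0 r1 /unit_diskP.
set a := complex.Re xi; set b := complex.Im xi => ab.
set M := fine _.
pose F s := r ^+ 2 * radial_weight phi r (1 - r ^+ 2 * s).
have r2 : 0 < r ^+ 2 by rewrite exprn_gt0.
have r21 : r ^+ 2 < 1 by rewrite expr_lt1 ?ltW.
have mF : measurable_fun setT F.
  apply: measurable_funM => //.
  apply: (measurableT_comp (measurable_radial_weight _ _ _ phi_cont r21)).
  by apply: measurable_funB => //; exact: measurable_funM.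
have F0 s : 0 <= F s.
  by rewrite mulr_ge0 ?(ltW r2)// divr_ge0 ?sqr_ge0.
have Fout s : ~~ (0 < s < 1) -> F s = 0.
  move=> s01; rewrite /F /radial_weight patchE ifF ?expr0n/= ?mul0r ?mulr0//.
  apply/negbTE; apply: contra s01; rewrite inE/= in_itv/= => /andP[h1 h2].
  by apply/andP; split; nra.
pose axis : set (R * R) := [set 0] `*` setT.
pose h (p : R * R) := radial_poisson F a b p.1 p.2.
have mh : measurable_fun setT (fun p => (h p)%:E).
  by apply/measurable_EFinP; exact: measurable_radial_poisson.
have h0 p : 0 <= h p by exact: radial_poisson_ge0.
have maxis : measurable axis by exact: measurableX.
(* H is infinite on the axis x = 0, a null set containing the origin, where the
   B_phi-norm gives no information. *)
pose H p := ((M ^+ 2)%:E * (h p)%:E + (cst +oo \_ axis) p)%E.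
have mc : measurable_fun setT (cst +oo \_ axis : R * R -> \bar R)%E.
  by apply/(measurable_restrictT _ _).1.
have c0 p : (0 <= (cst +oo \_ axis) p :> \bar R)%E.
  by rewrite patchE; case: ifP => _; rewrite ?le0y.
have mMh : measurable_fun setT (fun p => (M ^+ 2)%:E * (h p)%:E)%E.
  exact: measurable_funeM.
have Mh0 p : (0 <= (M ^+ 2)%:E * (h p)%:E)%E.
  by rewrite -EFinM lee_fin mulr_ge0 ?sqr_ge0.
have mH : measurable_fun setT H by exact: emeasurable_funD.
have H0 p : (0 <= H p)%E by exact: adde_ge0.
rewrite /disk_integral integral_mkcond.
apply: (@le_trans _ _ (\int[area_measure R]_p H p)%E).
  apply: ge0_le_integral_nonmeas => [p|[x y]].
    rewrite patchE; case: ifP => //; rewrite inE => /unit_diskP; rewrite -sqr_modc => pD.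
    rewrite lee_fin mulr_ge0 ?sqr_ge0// divr_ge0 ?sqr_ge0// mulr_ge0// subr_ge0 ltW//.
    by rewrite sqr_modc.
  rewrite patchE; case: ifPn => [|_]; last exact: H0.
  rewrite inE => /unit_diskP xy; rewrite /= in xy.
  rewrite /H patchE.
  have [x0|x0] := eqVneq x 0.
    rewrite ifT; last by rewrite inE /axis/=.
    rewrite /= addey ?leey// -EFinM//.
  rewrite ifF; last first.
    by apply/negbTE; rewrite notin_setE /axis/= => -[/eqP]; rewrite (negbTE x0).
  rewrite adde0 -EFinM lee_fin modc_poisson_den (sqr_modc _ xi).
  rewrite (sqr_modc _ (complex_of_pair _)).
  exact: BMOA_integrand_le.
rewrite /area_measure ge0_integral_mscale//=.
rewrite ge0_integralD//.
rewrite -[X in (_ + X)%E]integral_mkcond integral_cst//.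
rewrite [X in (_ + _ * X)%E](_ : _ = 0)%E; last exact: lebesgue2_vertical_axis.
rewrite mule0 adde0 ge0_integralZl_EFin ?sqr_ge0//; last by move=> p _; rewrite lee_fin.
rewrite muleCA; apply: lee_wpmul2l; first by rewrite lee_fin sqr_ge0.
rewrite -lee_pdivlMl ?invr_gt0 ?pi_gt0// invrK.
rewrite -(integral_radial_weight _ _ _ phi_cont r0 r1).
exact: integral_radial_poisson_le.
Qed.

Theorem theorem1 (R : realType) (phi : R -> R)
    (phi_gt0 : {in `]0, 1[, forall t : R, 0 < phi t})
    (phi_cont : {within `]0, 1[, continuous phi})
    (g_fin : {in `]0, 1[, forall x : R, (g_of phi x < +oo)%E})
    (f : R[i] -> R[i]) (fB : B_space phi f)
    (r : R) (r_gt0 : 0 < r) (r_lt1 : r < 1) :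
  (BMOA_norm (dilate r f) <= B_norm phi f * sqrte (g_of phi (1 - r ^+ 2)))%E.
Proof.
have B0 : (0 <= B_norm phi f)%E by exact: B_norm_ge0.
have Bfin : B_norm phi f \is a fin_num by rewrite ge0_fin_numE//; case: fB.
have g0 : (0 <= g_of phi (1 - r ^+ 2))%E.
  apply: integral_ge0 => t /=; rewrite in_itv/= => /andP[t0 _].
  rewrite lee_fin divr_ge0 ?sqr_ge0// ltW// (le_lt_trans _ t0)//.
  by rewrite subr_ge0 expr_le1 ?ltW.
rewrite -[X in (X * _)%E]gee0_abs// -sqrte_sqr -sqrteM ?sqre_ge0//.
rewrite lee_sqrt ?mule_ge0 ?sqre_ge0//.
apply: ge_ereal_sup => _ [xi xiD <-].
rewrite -(fineK Bfin) -EFin_expe.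
exact: disk_integral_le.
Qed.
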